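(* Define an index-based policy as any policy $\pi$ that can be described through a function $g(s_i,P_i,R)$, evaluated for each arm $i$, such that in state $\mathbf{s}$ the policy selects the $K$ arms with the largest values of $g(s_i,P_i,R)$. Then index-based policies achieve a discounted-reward approximation ratio no better than $\frac{1-\gamma}{1-\gamma^K}$. That is, for every such $g$, every budget $K\ge1$ and every discount factor $\gamma\in[0,1)$, there is an RMAB-G instance with budget $K$ and discount $\gamma$, and an initial state, for which the expected total discounted reward of the index-based policy given by $g$ is at most $\frac{1-\gamma}{1-\gamma^K}$ times the (positive) optimal expected total discounted reward.
   Context: An RMAB-G instance has $N$ arms with states in a finite set $\mathcal{S}$, actions in $\mathcal{A}=\{0,1\}$ (1 = pull), per-arm rewards $R_i:\mathcal{S}\times\mathcal{A}\to\mathbb{R}$, a global reward $R_{\mathrm{glob}}:\mathcal{S}^N\times\mathcal{A}^N\to\mathbb{R}$ that is, for each fixed $\mathbf{s}$, a monotone submodular set function of $\{i:a_i=1\}$, transition functions $P_i:\mathcal{S}\times\mathcal{A}\times\mathcal{S}\to[0,1]$ (arms transition independently given states and actions), a discount factor $\gamma\in[0,1)$, and a budget $K$. Policies $\pi:\mathcal{S}^N\to\mathcal{A}^N$ must pull at most $K$ arms in each time step. The total reward is $R(\mathbf{s},\mathbf{a})=R_{\mathrm{glob}}(\mathbf{s},\mathbf{a})+\sum_{i=1}^N R_i(s_i,a_i)$, and the objective is the expected total discounted reward $\mathbb{E}[\sum_{t\ge0}\gamma^tR(\mathbf{s}^{(t)},\mathbf{a}^{(t)})]$. *)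

(* Defs.v *)
From mathcomp Require Import all_boot all_order all_algebra.
From mathcomp Require Import all_classical all_reals all_analysis.
From mathcomp Require Import measurable_realfun lra.

Set Implicit Arguments.
Unset Strict Implicit.
Unset Printing Implicit Defensive.

Import Order.TTheory GRing.Theory Num.Theory.
Import numFieldNormedType.Exports.

Local Open Scope classical_set_scope.
Local Open Scope ring_scope.

Definition pulled (n : nat) (a : {ffun 'I_n -> bool}) : {set 'I_n} :=
  finset (fun i => a i).

Definition pull_set (n : nat) (A : {set 'I_n}) : {ffun 'I_n -> bool} :=
  [ffun i => i \in A].

Definition monotone_setfun (R : realType) (T : finType) (F : {set T} -> R) :=
  forall A B : {set T}, A \subset B -> F A <= F B.

Definition submodular (R : realType) (T : finType) (F : {set T} -> R) :=
  forall A B : {set T}, F (A :|: B) + F (A :&: B) <= F A + F B.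

(* The action [true] means that the arm is pulled. *)
Record rmabg (R : realType) := RMABG {
  narms : nat;
  state : finType;
  arm_reward : 'I_narms -> state -> bool -> R;
  global_reward : {ffun 'I_narms -> state} -> {ffun 'I_narms -> bool} -> R;
  arm_trans : 'I_narms -> state -> bool -> state -> R;
  discount : R;
  budget : nat;
  global_reward_monotone : forall s : {ffun 'I_narms -> state},
    monotone_setfun (fun A => global_reward s (pull_set A));
  global_reward_submodular : forall s : {ffun 'I_narms -> state},
    submodular (fun A => global_reward s (pull_set A));
  arm_trans_ge0 : forall i s a s', 0 <= arm_trans i s a s';
  arm_trans_sum1 : forall i s a, \sum_s' arm_trans i s a s' = 1;
  discount_ge0 : 0 <= discount;
  discount_lt1 : discount < 1;
  budget_le_narms : (budget <= narms)%N
}.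

Definition joint_state (R : realType) (M : rmabg R) : finType :=
  {ffun 'I_(narms M) -> state M}.

Definition joint_action (R : realType) (M : rmabg R) : finType :=
  {ffun 'I_(narms M) -> bool}.

Definition total_reward (R : realType) (M : rmabg R)
    (s : joint_state M) (a : joint_action M) : R :=
  global_reward s a + \sum_(i < narms M) arm_reward i (s i) (a i).

Definition joint_trans (R : realType) (M : rmabg R)
    (s : joint_state M) (a : joint_action M) (s' : joint_state M) : R :=
  \prod_(i < narms M) arm_trans i (s i) (a i) (s' i).

Definition policy (R : realType) (M : rmabg R) :=
  joint_state M -> joint_action M.

Definition feasible (R : realType) (M : rmabg R) (pi : policy M) :=
  forall s, (#|pulled (pi s)| <= budget M)%N.

(* [X] is a Markov chain with transition matrix [q] started at [s0], on the
   probability space [P]: its finite-dimensional laws are given by [q]. *)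
Definition markov_chain (R : realType) (S : finType) (q : S -> S -> R) (s0 : S)
    (d : measure_display) (T : measurableType d) (P : probability T R)
    (X : nat -> T -> S) : Prop :=
  (forall t s, measurable [set w | X t w = s]) /\
  (forall n (x : nat -> S),
     P [set w | forall t, (t <= n)%N -> X t w = x t] =
     ((x 0%N == s0)%:R * \prod_(t < n) q (x t) (x t.+1))%:E).

Section markov_chain_exists.
Context (R : realType) (S : finType) (q : S -> S -> R).
Hypothesis q0 : forall s u, 0 <= q s u.
Hypothesis q1 : forall s, \sum_u q s u = 1.

Let cum (s u : S) := \sum_(v | (enum_rank v < enum_rank u)%N) q s v.
Let slot (s u : S) (w : R) := cum s u <= w < cum s u + q s u.
Let next s w := odflt s [pick u | slot s u w].

Let cum_ge0 s u : 0 <= cum s u.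
Proof. exact: sumr_ge0. Qed.

Let cumS s u : cum s u + q s u = \sum_(v | (enum_rank v <= enum_rank u)%N) q s v.
Proof.
rewrite [RHS](bigD1 u)//= addrC; congr (_ + _); apply: eq_bigl => v.
rewrite ltn_neqAle andbC; congr (_ && _).
by rewrite -(inj_eq enum_rank_inj).
Qed.

Let sub_sum s (A B : pred S) : (forall v, A v -> B v) ->
  \sum_(v | A v) q s v <= \sum_(v | B v) q s v.
Proof.
move=> AB; rewrite [leRHS](bigID A)/= (eq_bigl A) ?lerDl ?sumr_ge0// => v.
by case: (boolP (A v)) => Av; rewrite ?andbF// AB.
Qed.

Let cum_le1 s u : cum s u + q s u <= 1.
Proof. by rewrite cumS -(q1 s); exact: sub_sum. Qed.

Let slot_lt s u v w : slot s u w -> slot s v w ->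
  (enum_rank u <= enum_rank v)%N.
Proof.
move=> /andP[ua ub] /andP[va vb]; rewrite leqNgt; apply/negP => vu.
suff: cum s v + q s v <= cum s u by move=> h; lra.
by rewrite cumS; apply: sub_sum => x /leq_ltn_trans; exact.
Qed.

Let slot_inj s u v w : slot s u w -> slot s v w -> u = v.
Proof.
move=> su sv; apply/enum_rank_inj/val_inj/eqP => /=.
by rewrite eqn_leq (slot_lt su sv) (slot_lt sv su).
Qed.

Let slot_ex s w : 0 <= w < 1 -> exists u, slot s u w.
Proof.
move=> /andP[w0 w1].
have [k] := ubnP (#|S|); elim: k => // k _ _.
have S0 : (0 < #|S|)%N by apply/card_gt0P; exists s.
pose z := enum_val (Ordinal S0).
have Pz : cum s z <= w.
  by rewrite /cum big1// => v; rewrite /z enum_valK.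
case: (arg_maxnP (fun u => enum_rank u : nat) (P := fun u => cum s u <= w) Pz).
move=> u uw umax; exists u; rewrite /slot uw/= ltNge; apply/negP => uqw.
have [us|us] := ltnP (enum_rank u).+1 #|S|.
  pose v := enum_val (Ordinal us).
  have : cum s v <= w.
    rewrite (le_trans _ uqw)// cumS; apply: sub_sum => x.
    by rewrite /v enum_valK.
  by move=> /umax; rewrite /v enum_valK/= ltnn.
suff : cum s u + q s u = 1 by lra.
rewrite cumS -(q1 s); apply: eq_bigl => v.
by rewrite -ltnS (leq_trans _ us).
Qed.

Let nextP s u w : 0 <= w < 1 -> (next s w == u) = slot s u w.
Proof.
move=> w01; rewrite /next; case: pickP => [v sv|no]/=.
  by apply/eqP/idP => [<-//|]; exact: slot_inj.
by have [v] := slot_ex s w01; rewrite no.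
Qed.

Let rescale s u w := (w - cum s u) / q s u.

Let slot_gt0 s u w : slot s u w -> 0 < q s u.
Proof. by rewrite /slot => /andP[? ?]; lra. Qed.

Let rescale01 s u w : slot s u w -> 0 <= rescale s u w < 1.
Proof.
move=> su; have quP := slot_gt0 su; case/andP: su => a b.
by rewrite /rescale divr_ge0 ?subr_ge0 ?(ltW quP)//= ltr_pdivrMr// mul1r; lra.
Qed.

Let Fixpoint path (n : nat) (s : S) (w : R) : S :=
  if n is m.+1 then path m (next s w) (rescale s (next s w) w) else s.

Let path_cyl n : forall x : nat -> S, exists lo,
  [/\ 0 <= lo, lo + \prod_(t < n) q (x t) (x t.+1) <= 1 &
  forall w, 0 <= w < 1 ->
  ((forall t, (t <= n)%N -> path t (x 0%N) w = x t) <->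
   lo <= w < lo + \prod_(t < n) q (x t) (x t.+1))].
Proof.
elim: n => [|n IH] x.
  exists 0; rewrite big_ord0 add0r; split => // w w01; split => // _ t.
  by rewrite leqn0 => /eqP ->.
have [lo [lo0 lo1 loP]] := IH (fun t => x t.+1).
rewrite big_ord_recl/=; set p := \prod_(i < n) _.
have pE : \prod_(i < n) q (x (bump 0 i)) (x (bump 0 i).+1) = p by [].
rewrite pE -/p in lo1 loP *.
have p0 : 0 <= p by exact: prodr_ge0.
set c := cum (x 0%N) (x 1%N); set Q := q (x 0%N) (x 1%N).
have Q0 : 0 <= Q by exact: q0.
have c0 : 0 <= c by exact: cum_ge0.
have cQ1 : c + Q <= 1 by exact: cum_le1.
exists (c + Q * lo).
have Qlo : Q * lo + Q * p <= Q by rewrite -mulrDr ler_piMr.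
split; [by rewrite addr_ge0// mulr_ge0 | by lra |].
move=> w w01; split.
- move=> xw.
  have /eqP := xw 1%N isT; rewrite /= nextP// => sw.
  have := loP _ (rescale01 sw).
  case=> + _; have /eqP nw : next (x 0%N) w == x 1%N by rewrite nextP.
  have h : (forall t, (t <= n)%N ->
     path t (x 1%N) (rescale (x 0%N) (x 1%N) w) = x t.+1).
    by move=> t tn; rewrite -(xw t.+1)//= nw.
  have Qp := slot_gt0 sw.
  move=> /(_ h)/andP[]; rewrite /rescale -/c -/Q in Qp *.
  rewrite ler_pdivlMr// ltr_pdivrMr// => a b; apply/andP; split; nra.
- move=> /andP[a b].
  have Qlo0 : 0 <= Q * lo by exact: mulr_ge0.
  have sw : slot (x 0%N) (x 1%N) w.
    rewrite /slot -/c -/Q; apply/andP; split; lra.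
  have /eqP nw : next (x 0%N) w == x 1%N by rewrite nextP.
  have Qp := slot_gt0 sw.
  have [_] := loP _ (rescale01 sw).
  have -> : lo <= rescale (x 0%N) (x 1%N) w < lo + p.
    rewrite /rescale -/c -/Q in Qp *.
    by rewrite ler_pdivlMr// ltr_pdivrMr//; apply/andP; split; nra.
  by move=> /(_ isT) h [|t]//= tn; rewrite nw h.
Qed.

Let I01 : set R := [set w | 0 <= w < 1].

Let mitv (a b : R) : measurable [set w : measurableTypeR R | a <= w < b].
Proof.
rewrite (_ : [set _ | _] = `[a, b[%classic); first exact: measurable_itv.
by apply/seteqP; split => w /=; rewrite in_itv.
Qed.

Let mpath n : forall s u,
  measurable [set w : measurableTypeR R | I01 w /\ path n s w = u].
Proof.
elim: n => [|n IH] s u.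
  have [<-|su] := pselect (s = u).
    rewrite (_ : [set _ | _] = I01); first exact: mitv.
    by apply/seteqP; split => w //= [].
  rewrite (_ : [set _ | _] = set0); first exact: measurable0.
  by apply/seteqP; split => w //= [].
rewrite (_ : [set _ | _] = \bigcup_(v in [set: S])
   ([set w | I01 w /\ slot s v w] `&`
    (rescale s v @^-1` [set w | I01 w /\ path n v w = u]))).
  apply: fin_bigcup_measurable; first exact: finite_finset.
  move=> v _; apply: measurableI.
    apply: measurableI; exact: mitv.
  rewrite -[X in measurable X]setTI; apply: (_ : measurable_fun setT _) => //.
  rewrite /rescale; apply: measurable_funM => //.
    exact: measurable_funB.
  exact: IH.
apply/seteqP; split => w /=.
  move=> [w01 <-]; exists (next s w) => //.
  have sw : slot s (next s w) w by rewrite -nextP.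
  by split; split => //; exact: rescale01.
move=> [v _ [[w01 sw] [_ <-]]]; split => //.
by have /eqP -> : next s w == v by rewrite nextP.
Qed.

Let uniform_itv (a b : R) : 0 <= a -> a <= b -> b <= 1 ->
  uniform_prob (@ltr01 R) [set w | a <= w < b] = (b - a)%:E.
Proof.
move=> a0 ab b1; rewrite /uniform_prob.
rewrite (_ : [set _ | _] = `[a, b[%classic); last first.
  by apply/seteqP; split => w /=; rewrite in_itv.
rewrite (eq_integral (fun=> 1%:E)); last first.
  move=> w; rewrite inE/= in_itv/= => /andP[aw wb].
  rewrite /uniform_pdf subr0 invr1 ifT//; apply/andP; split; lra.
rewrite integral_cst//= lebesgue_measure_itv/= lte_fin mul1e.
have [//|ba] := ltP a b.
have -> : b = a by apply/eqP; rewrite eq_le ba ab.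
by rewrite subrr.
Qed.

(* The trajectory is read off a uniform point of [0, 1[ by splitting each
   interval into slots of relative lengths q s u. *)
Lemma markov_chain_exists (s0 : S) :
  exists (d : measure_display) (T : measurableType d) (P : probability T R)
    (X : nat -> T -> S), markov_chain q s0 P X.
Proof.
exists _, (measurableTypeR R), (uniform_prob (@ltr01 R)).
exists (fun t w => if 0 <= w < 1 then path t s0 w else s0); split.
  move=> t s.
  have mp := mpath t s0 s.
  rewrite (_ : [set w | _] = [set w | I01 w /\ path t s0 w = s] `|`
     (~` I01 `&` [set w | s0 = s])).
    apply: measurableU => //; apply: measurableI.
      by apply: measurableC; exact: mitv.
    have [->|ne] := pselect (s0 = s).
      by rewrite (_ : [set _ | _] = setT)//; apply/seteqP; split.
    by rewrite (_ : [set _ | _] = set0)//; apply/seteqP; split.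
  apply/seteqP; split => w /=; rewrite /I01/=; case: ifPn => w01 h.
  - by left.
  - by right; split => //; exact/negP.
  - by case: h => [[]//|[nw]]; case: nw.
  - by case: h => [[w1]|[_]//]; move: w1.
move=> n x; have [x0|x0] := eqVneq (x 0%N) s0; last first.
  rewrite mul0r (_ : [set _ | _] = set0) ?measure0//.
  apply/seteqP; split => w //= /(_ 0%N isT).
  by case: ifP => _ /= /esym/eqP; rewrite (negbTE x0).
have [lo [lo0 lo1 loP]] := path_cyl n x.
rewrite mul1r; set p := \prod_(t < n) _ in lo1 loP *.
have p0 : 0 <= p by exact: prodr_ge0.
set A := (X in _ X = _).
pose C := [set w : R | s0 = x 0%N /\ forall t, (t <= n)%N -> s0 = x t].
have AE : A = [set w | lo <= w < lo + p] `|` (~` I01 `&` C).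
  apply/seteqP; split => w; rewrite /A /I01 /C/= => h.
    have [w01|w01] := boolP (0 <= w < 1).
      by left; apply/loP => // t tn; have := h t tn; rewrite w01 x0.
    right; split; first exact/negP.
    by split => // t tn; have := h t tn; rewrite (negbTE w01).
  move=> t tn; case: h => [h|[/negP/negbTE -> [_]]]; last exact.
  have w01 : 0 <= w < 1.
    by case/andP: h => a b; apply/andP; split; lra.
  by rewrite w01 -x0; have [_] := loP w w01; apply.
have mC : measurable (C : set (measurableTypeR R)).
  have [h|h] := pselect (s0 = x 0%N /\ forall t, (t <= n)%N -> s0 = x t).
    rewrite (_ : C = setT); first exact: measurableT.
    by apply/seteqP; split.
  rewrite (_ : C = set0); first exact: measurable0.
  by apply/seteqP; split.
have mI : measurable (I01 : set (measurableTypeR R)) by exact: mitv.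
have PI0 : uniform_prob (@ltr01 R) (~` I01) = 0%E.
  have := @probability_setC _ _ _ (uniform_prob (@ltr01 R)) _ mI.
  by move=> ->; rewrite /I01 /= (uniform_itv _ ler01)// subr0 subee.
rewrite AE measureU.
- rewrite [X in (_ + X)%E](_ : _ = 0%E).
    rewrite adde0; transitivity (uniform_prob (@ltr01 R) [set w | lo <= w < lo + p]) => //.
    by rewrite uniform_itv ?lerDl// addrAC subrr add0r.
  apply/eqP; rewrite eq_le measure_ge0 andbT -PI0; apply: le_measure.
  + by rewrite inE; exact: measurableI (measurableC mI) mC.
  + by rewrite inE; exact: measurableC.
  + exact: subIsetl.
- exact: mitv.
- exact: measurableI (measurableC mI) mC.
- apply/seteqP; split => w //= [/andP[a b] [+ _]]; case.
  by rewrite /I01/=; apply/andP; split; lra.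
Qed.
End markov_chain_exists.

Definition policy_trans (R : realType) (M : rmabg R) (pi : policy M)
    (s s' : joint_state M) : R := joint_trans s (pi s) s'.

Lemma policy_trans_ge0 (R : realType) (M : rmabg R) (pi : policy M) s s' :
  0 <= policy_trans pi s s'.
Proof. by apply: prodr_ge0 => i _; exact: arm_trans_ge0. Qed.

Lemma policy_trans_sum1 (R : realType) (M : rmabg R) (pi : policy M) s :
  \sum_s' policy_trans pi s s' = 1.
Proof.
rewrite /policy_trans /joint_trans.
rewrite -(bigA_distr_bigA (fun i u => arm_trans i (s i) (pi s i) u)).
by rewrite big1// => i _; exact: arm_trans_sum1.
Qed.

Definition discounted_sum (R : realType) (M : rmabg R) (pi : policy M)
    (x : nat -> joint_state M) : R :=
  limn (series (fun t => discount M ^+ t * total_reward (x t) (pi (x t)))).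

Definition is_value (R : realType) (M : rmabg R) (pi : policy M)
    (s0 : joint_state M) (v : \bar R) : Prop :=
  exists (d : measure_display) (T : measurableType d) (P : probability T R)
         (X : nat -> T -> joint_state M),
    markov_chain (policy_trans pi) s0 P X /\
    v = ('E_P[fun w => discounted_sum pi (X ^~ w)])%E.

(* The value does not depend on the probability space carrying the trajectory,
   since the finite-dimensional laws are prescribed; [valueP] below shows that
   such a space always exists. *)
Definition value (R : realType) (M : rmabg R) (pi : policy M)
    (s0 : joint_state M) : \bar R := xget 0%E [set v | is_value pi s0 v].

Lemma valueP (R : realType) (M : rmabg R) (pi : policy M) s0 :
  is_value pi s0 (value pi s0).
Proof.
rewrite /value; apply: (@xgetPex _ 0%E [set v | is_value pi s0 v]).
have [d [T [P [X XP]]]] := markov_chain_exists (@policy_trans_ge0 _ _ pi)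
  (@policy_trans_sum1 _ _ pi) s0.
by exists ('E_P[fun w => discounted_sum pi (X ^~ w)])%E, d, T, P, X.
Qed.

Definition optimal_value (R : realType) (M : rmabg R) (s0 : joint_state M) :
  \bar R := ereal_sup [set value pi s0 | pi in [set pi | feasible pi]].

(* The index sees the state of the arm, its transition function and the total
   reward function, but not the label of the arm. *)
Definition index_function (R : realType) :=
  forall (S : finType) (n : nat),
    S -> (S -> bool -> S -> R) ->
    ({ffun 'I_n -> S} -> {ffun 'I_n -> bool} -> R) -> R.

Definition arm_index (R : realType) (g : index_function R) (M : rmabg R)
    (s : joint_state M) (i : 'I_(narms M)) : R :=
  g (state M) (narms M) (s i) (arm_trans i) (@total_reward R M).

(* Ties between indices may be broken arbitrarily, and differently in
   different states. *)
Definition index_policy (R : realType) (g : index_function R) (M : rmabg R)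
    (pi : policy M) : Prop :=
  forall s, #|pulled (pi s)| = budget M /\
    forall i j, i \in pulled (pi s) -> j \notin pulled (pi s) ->
      arm_index g s j <= arm_index g s i.

Lemma index_policy_feasible (R : realType) (g : index_function R) (M : rmabg R)
    (pi : policy M) : index_policy g pi -> feasible pi.
Proof. by move=> gpi s; have [->] := gpi s. Qed.

Lemma index_policy_exists (R : realType) (g : index_function R) (M : rmabg R) :
  exists pi : policy M, index_policy g pi.
Proof.
pose le s i j := arm_index g (M := M) s j <= arm_index g s i.
pose top s := take (budget M) (sort (le s) (enum 'I_(narms M))).
exists (fun s => pull_set (finset (mem (top s)))) => s.
have pE i : (i \in pulled (pull_set (finset (mem (top s))))) = (i \in top s).
  by rewrite inE ffunE inE.
split.
  rewrite (eq_card pE) (card_uniqP _) ?take_uniq ?sort_uniq ?enum_uniq//.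
  by rewrite size_take_min size_sort size_enum_ord; apply/minn_idPl/budget_le_narms.
move=> i j; rewrite !pE => iT jT.
have : pairwise (le s) (sort (le s) (enum 'I_(narms M))).
  rewrite -sorted_pairwise; last by move=> x y z xy yz; exact: le_trans xy.
  by apply: sort_sorted => x y; exact: le_total.
rewrite -[X in pairwise _ X](cat_take_drop (budget M)) pairwise_cat.
move=> /andP[/allrelP/(_ i j iT) + _]; apply.
have : j \in sort (le s) (enum 'I_(narms M)) by rewrite mem_sort mem_enum.
rewrite -{1}[sort _ _](cat_take_drop (budget M)) mem_cat.
by rewrite -[take _ _]/(top s) (negbTE jT).
Qed.

(* Main.v *)
Require Import Defs.
From mathcomp Require Import all_boot all_order all_algebra.
From mathcomp Require Import all_classical all_reals all_analysis.
From mathcomp Require Import measurable_realfun.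
Set Implicit Arguments.
Unset Strict Implicit.
Unset Printing Implicit Defensive.

Import Order.TTheory GRing.Theory Num.Theory.
Import numFieldNormedType.Exports.
Local Open Scope ring_scope.

(** An index policy is forced to pull exactly [K] arms. Take [K] arms, all
    active at the start, where a pull deactivates an arm for good and the reward
    is 1 whenever at least one active arm is pulled. With only [K] arms every
    index policy pulls all of them at once and collects 1 in total, whatever [g]
    is, whereas pulling the active arms one after the other collects
    [1 + gamma + ... + gamma ^ (K - 1) = (1 - gamma ^ K) / (1 - gamma)]. *)

(** * Bounds and measurability for discounted sums *)

Definition reward_bound (R : realType) (M : rmabg R) : R :=
  \sum_(s : joint_state M) \sum_(a : joint_action M) `|total_reward s a|.

Lemma total_reward_bound (R : realType) (M : rmabg R)
    (s : joint_state M) (a : joint_action M) :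
  `|total_reward s a| <= reward_bound M.
Proof.
rewrite /reward_bound (bigD1 s)//= (bigD1 a)//= -addrA lerDl.
by rewrite addr_ge0// sumr_ge0// => ? _; rewrite sumr_ge0.
Qed.

Section discounted_sum.
Context (R : realType) (M : rmabg R) (pi : policy M).
Implicit Type x : nat -> joint_state M.

Let term x t := discount M ^+ t * total_reward (x t) (pi (x t)).

Let normr_discount_lt1 : `|discount M| < 1.
Proof. by rewrite ger0_norm ?discount_ge0 ?discount_lt1. Qed.

Let normr_term_le x t :
  `|term x t| <= geometric (reward_bound M) (discount M) t.
Proof.
rewrite /term normrM ger0_norm ?exprn_ge0 ?discount_ge0// /geometric/= mulrC.
by rewrite ler_wpM2r ?exprn_ge0 ?discount_ge0// total_reward_bound.
Qed.

Let is_cvg_normed x : cvgn [normed series (term x)].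
Proof.
apply: (@series_le_cvg _ _ (geometric (reward_bound M) (discount M))).
- by move=> n; exact: normr_ge0.
- by move=> n; exact: le_trans (normr_ge0 _) (normr_term_le x n).
- exact: normr_term_le.
- exact: is_cvg_geometric_series.
Qed.

Lemma is_cvg_discounted_sum x : cvgn (series (fun t =>
  discount M ^+ t * total_reward (x t) (pi (x t)))).
Proof. by apply: normed_cvg; exact: is_cvg_normed. Qed.

Lemma normr_discounted_sum_le x :
  `|discounted_sum pi x| <= reward_bound M / (1 - discount M).
Proof.
have cg := cvg_geometric_series (a := reward_bound M) normr_discount_lt1.
rewrite -(cvg_lim _ cg)//; apply: (le_trans (lim_series_norm (@is_cvg_normed x))).
apply: lim_series_le; first exact: is_cvg_normed.
- exact: is_cvg_geometric_series.
- exact: normr_term_le.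
Qed.

(** A pointwise limit of finite sums, each term of which depends on [w] only through the finitely
    valued [X t w]. *)
Lemma measurable_discounted_sum d (T : measurableType d)
    (X : nat -> T -> joint_state M) :
  (forall t s, measurable [set w | X t w = s]%classic) ->
  measurable_fun setT (fun w => discounted_sum pi (X ^~ w)).
Proof.
move=> mX.
apply: (measurable_fun_cvg
  (h := fun n w => series (term (X ^~ w)) n)); last first.
  by move=> w _; exact: is_cvg_discounted_sum.
move=> n; apply: measurable_sum => t; apply: measurable_funM => //.
move=> _ Y _; rewrite setTI.
rewrite (_ : _ @^-1` _ = \bigcup_(s in [set s | Y (total_reward s (pi s))])
  [set w | X t w = s])%classic; last first.
  by apply/seteqP; split => [w Yw|w [s Ys /= Xs]]; [exists (X t w)|rewrite /= Xs].
by apply: fin_bigcup_measurable => // s _; exact: mX.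
Qed.

(** The bound is the same for all policies, which is what makes the supremum over policies
    finite. *)
Lemma value_le s0 : (value pi s0 <= (reward_bound M / (1 - discount M))%:E)%E.
Proof.
have [d [T [P [X [[mX _] ->]]]]] := valueP pi s0.
have mV := measurable_discounted_sum mX.
rewrite unlock; apply: le_trans (lee_abs _) _.
apply: le_trans (le_abse_integral _ _ _) _ => //.
  exact/measurable_EFinP.
apply: le_trans (ge0_le_integral _ (f2 := cst _%:E) _ _ _ _ _) _ => //.
- by apply: measurableT_comp => //; exact/measurable_EFinP.
- by move=> w _; rewrite /= lee_fin; exact: normr_discounted_sum_le.
- by rewrite integral_cst// [X in (_ * X)%E]probability_setT mule1.
Qed.

(** Almost every trajectory is the orbit of [s0] under [f], so the expectation is that of a
    constant, on whichever probability space [valueP] supplies. *)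
Lemma value_deterministic (f : joint_state M -> joint_state M) s0 :
  (forall s, policy_trans pi s (f s) = 1) ->
  value pi s0 = (discounted_sum pi (fun t => iter t f s0))%:E.
Proof.
move=> f1; have [d [T [P [X [[mX PX] ->]]]]] := valueP pi s0.
have Xf : \forall w \ae P, forall t, X t w = iter t f s0.
  apply: ae_foralln => t.
  have mA : measurable [set w | X t w = iter t f s0]%classic by exact: mX.
  exists (~` [set w | X t w = iter t f s0])%classic; split => //.
    exact: measurableC.
  rewrite [LHS]probability_setC//; apply/eqP; rewrite sube_eq//.
  rewrite add0e eq_le probability_le1// andbT.
  (* The event at time [t] contains the cylinder following the orbit up to [t], whose probability is
     a product of ones. *)
  have <- : P [set w | forall k, (k <= t)%N -> X k w = iter k f s0]%classic
      = 1%E.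
    by rewrite (PX t (fun k => iter k f s0)) eqxx mul1r big1//.
  apply: le_measure; rewrite ?inE//.
    rewrite (_ : mkset _ = \bigcap_(k in [set k | (k <= t)%N])
      [set w | X k w = iter k f s0])%classic; last by [].
    by apply: bigcap_measurableType => // k _; exact: mX.
  by move=> w /=; apply.
rewrite unlock (ae_eq_integral (cst (discounted_sum pi
  (fun t => iter t f s0))%:E))//.
- by rewrite integral_cst// [X in (_ * X)%E]probability_setT mule1.
- by apply/measurable_EFinP; exact: measurable_discounted_sum.
- apply: filterS Xf => w Xw _ /=; congr (_%:E).
  by congr (discounted_sum _ _); apply/funext.
Qed.

End discounted_sum.

Lemma optimal_value_lty (R : realType) (M : rmabg R) (s0 : joint_state M) :
  (optimal_value s0 < +oo)%E.
Proof.
apply: (@le_lt_trans _ _ (reward_bound M / (1 - discount M))%:E).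
  by apply: ge_ereal_sup => _ [pi _ <-]; exact: value_le.
exact: ltry.
Qed.

(** * The instance with [K] arms and budget [K] *)

Section one_shot.
Context (R : realType) (K : nat) (gamma : R).
Hypotheses (gamma0 : 0 <= gamma) (gamma1 : gamma < 1).

(** For fixed [s], the rank function of a matroid of rank at most one whose loops are the inactive
    arms. *)
Let global (s : {ffun 'I_K -> bool}) (a : {ffun 'I_K -> bool}) : R :=
  [exists i, s i && a i]%:R.

(** As [&&] binds tighter than [==], this is the point mass at [s && ~~ a]. *)
Let trans (i : 'I_K) (s a s' : bool) : R := (s' == s && ~~ a)%:R.

Let global_monotone s : monotone_setfun (fun A => global s (pull_set A)).
Proof.
move=> A B AB; rewrite /global ler_nat.
set u := [exists _, _]; set v := [exists _, _].
suff uv : u -> v by case: u v uv => [] [] // /(_ isT).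
move=> /existsP[i]; rewrite ffunE => /andP[si iA].
by apply/existsP; exists i; rewrite ffunE si (fintype.subsetP AB).
Qed.

(** An active arm of the union lies in one of the two sets, one of the intersection lies in both,
    and [(a || b) + (a && b) = a + b] for truth values. *)
Let global_submodular s : submodular (fun A => global s (pull_set A)).
Proof.
move=> A B; rewrite /global -!natrD ler_nat.
set u := [exists _, _]; set v := [exists _, _].
set a := [exists _, _]; set b := [exists _, _].
have uab : u -> a || b.
  move=> /existsP[i]; rewrite ffunE inE => /andP[si /orP[]] h; apply/orP.
    by left; apply/existsP; exists i; rewrite ffunE si.
  by right; apply/existsP; exists i; rewrite ffunE si.
have vab : v -> a && b.
  move=> /existsP[i]; rewrite ffunE inE => /and3P[si iA iB].
  by apply/andP; split; apply/existsP; exists i; rewrite ffunE si.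
by move/implyP: uab; move/implyP: vab; case: u; case: v; case: a; case: b.
Qed.

Let trans_ge0 i s a s' : 0 <= trans i s a s'.
Proof. exact: ler0n. Qed.

Let trans_sum1 i s a : \sum_s' trans i s a s' = 1.
Proof. by rewrite big_bool /trans; case: s; case: a; rewrite /= ?addr0 ?add0r. Qed.

Definition one_shot : rmabg R := RMABG (fun _ _ _ => 0) global_monotone
  global_submodular trans_ge0 trans_sum1 gamma0 gamma1 (leqnn K).

Definition all_active : joint_state one_shot := [ffun=> true].

Definition deactivate (pi : policy one_shot) (s : joint_state one_shot) :
  joint_state one_shot := [ffun i => s i && ~~ pi s i].

Lemma one_shot_rewardE (s : joint_state one_shot) (a : joint_action one_shot) :
  total_reward s a = [exists i, s i && a i]%:R.
Proof. by rewrite /total_reward big1// addr0. Qed.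

Lemma one_shot_value (pi : policy one_shot) s0 :
  value pi s0 =
  (discounted_sum pi (fun t => iter t (deactivate pi) s0))%:E.
Proof.
apply: value_deterministic => s; rewrite /policy_trans /joint_trans.
by rewrite big1// => i _; rewrite /= /trans ffunE eqxx.
Qed.

(** Pulling [K] out of [K] arms leaves no active arm after the first step, so only the term at time
    0 can be nonzero. *)
Lemma pull_all_value (pi : policy one_shot) s0 :
  (forall s, #|pulled (pi s)| = K) -> (value pi s0 <= 1%:E)%E.
Proof.
move=> piK; rewrite one_shot_value lee_fin.
have piT s i : pi s i.
  have : pulled (pi s) = [set: 'I_K].
    by apply/eqP; rewrite eqEcard finset.subsetT/= piK cardsT card_ord.
  by move=> /setP/(_ i); rewrite !inE.
apply: limr_le; first exact: is_cvg_discounted_sum.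
(* Every partial sum is at most 1: the empty one is 0, and the others reduce to their first term. *)
apply: nearW => -[|n]; rewrite /series/=; first by rewrite big_geq.
rewrite big_nat_recl// big1_seq ?addr0 => [|t _].
  by rewrite expr0 mul1r one_shot_rewardE lern1 leq_b1.
rewrite one_shot_rewardE (_ : [exists _, _] = false) ?mulr0//.
by apply/existsP => -[i]; rewrite iterS ffunE piT andbF.
Qed.

(** Going through the active arms by increasing label gives the trajectory a closed form. *)
Definition pull_first : policy one_shot :=
  fun s => [ffun i => s i && [forall j : 'I_K, (j < i)%N ==> ~~ s j]].

Lemma pull_firstP (s : joint_state one_shot) (i j : 'I_K) :
  pull_first s i -> s j -> (i <= j)%N.
Proof.
rewrite ffunE => /andP[_ /forallP/(_ j)].
by case: leqP => //= _ /negP sj /sj.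
Qed.

Lemma pull_first_card s : (#|pulled (pull_first s)| <= 1)%N.
Proof.
have sub i : pull_first s i -> s i by rewrite ffunE => /andP[].
apply/card_le1_eqP => i j; rewrite !inE => si sj; apply/val_inj/eqP => /=.
by rewrite eqn_leq (pull_firstP si (sub j sj)) (pull_firstP sj (sub i si)).
Qed.

(** Induction on time: at time [t] the first active arm is arm [t], which is then the only one to be
    deactivated. *)
Lemma pull_first_reach t (i : 'I_K) :
  iter t (deactivate pull_first) all_active i = (t <= i)%N.
Proof.
elim: t i => [|t IH] i; first by rewrite ffunE.
rewrite iterS !ffunE IH; case: (ltngtP t i) => //= ti.
  (* For [t < i], arm [t] is still active and comes before [i], so [i] is spared. *)
  apply/negP => /forallP/(_ (Ordinal (ltn_trans ti (ltn_ord i)))).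
  by rewrite IH/= ti leqnn.
apply/negbF/forallP => j; apply/implyP => ji.
by rewrite IH -ltnNge ti.
Qed.

Lemma pull_first_value :
  (((1 - gamma ^+ K) / (1 - gamma))%:E <= value pull_first all_active)%E.
Proof.
rewrite one_shot_value lee_fin.
have -> : (1 - gamma ^+ K) / (1 - gamma) = \sum_(t < K) gamma ^+ t.
  rewrite -[1 - gamma ^+ K]opprB subrX1 -mulNr opprB mulrAC divff ?mul1r//.
  by rewrite subr_eq0 gt_eqF.
pose x t := iter t (deactivate pull_first) all_active.
have hit (t : 'I_K) : total_reward (x t) (pull_first (x t)) = 1.
  rewrite one_shot_rewardE (_ : [exists _, _])//; apply/existsP; exists t.
  rewrite ffunE /x pull_first_reach leqnn/=; apply/forallP => j.
  by apply/implyP => jt; rewrite pull_first_reach -ltnNge.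
(* Rewards are nonnegative, so the partial sum of the first [K] terms, each with reward 1, bounds
   the limit from below. *)
apply: (le_trans _ (@nondecreasing_cvgn_le _ (series (fun t =>
  gamma ^+ t * total_reward (x t) (pull_first (x t)))) _ _ K)).
- by rewrite /series/= big_mkord; apply: ler_sum => t _; rewrite hit mulr1.
- apply/nondecreasing_seqP => n; rewrite seriesSr lerDl mulr_ge0 ?exprn_ge0//.
  by rewrite one_shot_rewardE.
- exact: (@is_cvg_discounted_sum R one_shot pull_first x).
Qed.

End one_shot.

(** * Comparison of the two values *)

Theorem lemma8 (R : realType) (g : index_function R) (K : nat) (gamma : R) :
  (1 <= K)%N -> 0 <= gamma -> gamma < 1 ->
  exists (M : rmabg R) (s0 : joint_state M),
    [/\ budget M = K, discount M = gamma,
        (0 < optimal_value s0 < +oo)%E &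
        forall pi : policy M, index_policy g pi ->
          (value pi s0 <= ((1 - gamma) / (1 - gamma ^+ K))%:E * optimal_value s0)%E].
Proof.
move=> K1 gamma0 gamma1.
have cgamma : 0 < 1 - gamma by rewrite subr_gt0.
(* [1 <= K] keeps the denominator of the ratio away from 0. *)
have cgammaK : 0 < 1 - gamma ^+ K by rewrite subr_gt0 exprn_ilt1// -lt0n.
pose s0 := all_active K gamma0 gamma1.
have opt_ge : (((1 - gamma ^+ K) / (1 - gamma))%:E <= optimal_value s0)%E.
  apply: le_trans (pull_first_value K gamma0 gamma1) _.
  apply: ereal_sup_ubound; exists (@pull_first R K gamma gamma0 gamma1) => // s.
  exact: leq_trans (pull_first_card s) K1.
exists (one_shot K gamma0 gamma1), s0; split => //.
  rewrite optimal_value_lty andbT; apply: lt_le_trans opt_ge.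
  by rewrite lte_fin divr_gt0.
move=> pi gpi.
apply: (@le_trans _ _ 1%:E); first by apply: pull_all_value => s; have [] := gpi s.
(* The ratio times the lower bound on the optimum is exactly 1. *)
apply: le_trans (lee_wpmul2l _ opt_ge); last by rewrite lee_fin divr_ge0 ?ltW.
by rewrite -EFinM lee_fin mulrA divfK ?divff ?gt_eqF.
Qed.
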